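(* Let $a,b \in \mathbb{R} \cup \{\pm \infty\}$ and let $f,g$ be integrable functions such that for every $n \in \mathbb{Z}_{\ge 0}$, \[ C_n = \frac{1}{n+1}\int_a^b \bigl(f(x)\bigr)^{2n}g(x)\, dx. \] For $m\ge 1$ define \[ \varphi_m(x) = \frac{1}{m}\bigl((1+f(x))^m+(1-f(x))^m-2\bigr). \] Then for every $n \in \mathbb{Z}_{\ge 0}$, \[ M_n= \int_a^b \frac{\varphi_{n+2}(x)-\varphi_{n+1}(x)}{(f(x))^2}\,g(x)\, dx. \]
   Context: $C_n = \frac{1}{n+1}\binom{2n}{n}$ denotes the $n$-th Catalan number and $M_n = \sum_{k=0}^{\lfloor n/2\rfloor}\binom{n}{2k}C_k$ denotes the $n$-th Motzkin number, for $n\in\mathbb{Z}_{\ge 0}=\{0,1,2,\dots\}$. *)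

(* Defs.v *)
From HB Require Import structures.
From mathcomp Require Import all_boot all_order all_algebra.
From mathcomp Require Import all_classical all_reals all_analysis.

Set Implicit Arguments.
Unset Strict Implicit.
Unset Printing Implicit Defensive.

Import Order.TTheory GRing.Theory Num.Theory.
Import numFieldNormedType.Exports.

Local Open Scope classical_set_scope.
Local Open Scope ring_scope.

Definition catalan (R : realType) (n : nat) : R :=
  n.+1%:R^-1 * 'C(2 * n, n)%:R.

Definition motzkin (R : realType) (n : nat) : R :=
  \sum_(k < (n %/ 2).+1) 'C(n, 2 * k)%:R * catalan R k.

(* No order between the endpoints is assumed. *)
Definition between (R : realType) (a b : \bar R) : set R :=
  [set x : R | (Order.min a b < x%:E < Order.max a b)%E].

(* Oriented Lebesgue integral. An extended-real integral with a finite value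
   forces a measurable integrand to be Lebesgue integrable, so equating it with
   a real number also asserts that the integral converges absolutely. *)
Definition oriented_integral (R : realType) (a b : \bar R) (h : R -> R) : \bar R :=
  if (a <= b)%E then (\int[@lebesgue_measure R]_(x in between a b) (h x)%:E)%E
  else (- \int[@lebesgue_measure R]_(x in between a b) (h x)%:E)%E.

Definition phi (R : realType) (f : R -> R) (m : nat) (x : R) : R :=
  m%:R^-1 * ((1 + f x) ^+ m + (1 - f x) ^+ m - 2).

(* (phi_(n+2) - phi_(n+1)) / f ^ 2. Where f x = 0 this is 0 / 0; as a function of
   the value y = f x the quotient has a removable singularity at y = 0, filled
   here by its limit (the convention 0^-1 = 0 would give 0 instead). *)
Definition phi_quotient (R : realType) (f : R -> R) (n : nat) (x : R) : R :=
  if f x == 0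
  then lim ((phi id n.+2 y - phi id n.+1 y) / y ^+ 2 @[y --> (0 : R)^'])
  else (phi f n.+2 x - phi f n.+1 x) / f x ^+ 2.

(* Main.v *)
Require Import Defs.
From HB Require Import structures.
From mathcomp Require Import all_boot all_order all_algebra.
From mathcomp Require Import all_classical all_reals all_analysis.
From mathcomp Require Import measurable_realfun ring zify.

Import Order.TTheory GRing.Theory Num.Theory.
Import numFieldNormedType.Exports.

Local Open Scope classical_set_scope.
Local Open Scope ring_scope.

(** Binomial expansion gives
      phi_m(y) = sum_(k >= 0) C(m-1, 2k+1) / (k+1) * y^(2k+2),
    so by Pascal's rule (phi_(n+2)(y) - phi_(n+1)(y)) / y^2 is the polynomial
      sum_k C(n, 2k) / (k+1) * y^(2k),
    also in the limit y = 0. Integrating it at y = f x against g term by term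
    turns each y^(2k) / (k+1) into the Catalan number C_k, which leaves M_n.
    Term by term integration is legitimate: the hypothesis makes each
    integral of f^(2k) * g finite, hence absolutely convergent. *)

Definition phi_quotient_poly (R : realType) (n : nat) (y : R) : R :=
  \sum_(k < (n %/ 2).+1) 'C(n, 2 * k)%:R / k.+1%:R * y ^+ (2 * k).

Lemma sum_even_odd (V : nmodType) (F : nat -> V) (N : nat) :
  \sum_(i < 2 * N) F i = \sum_(k < N) (F (2 * k)%N + F (2 * k).+1).
Proof.
elim: N => [|N IH]; first by rewrite muln0 !big_ord0.
by rewrite mulnS 2!big_ord_recr big_ord_recr /= IH addrA.
Qed.

(** Binomials beyond [m] vanish, so the range can be freed from [m]; different powers then expand
    over one common index set. *)
Lemma expr1D_widen (R : comPzRingType) (y : R) (m M : nat) : (m < M)%N ->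
  (1 + y) ^+ m = \sum_(i < M) 'C(m, i)%:R * y ^+ i.
Proof.
move=> mM; rewrite exprDn.
under eq_bigr do rewrite expr1n mul1r -mulr_natl.
rewrite (big_ord_widen M (fun i => 'C(m, i)%:R * y ^+ i))// big_mkcond /=.
by apply: eq_bigr => i _; case: ltnP => // mi; rewrite bin_small// mul0r.
Qed.

(** Odd powers of [y] cancel and even ones double. *)
Lemma expr1D_expr1B (R : comPzRingType) (y : R) (m N : nat) : (m < 2 * N)%N ->
  (1 + y) ^+ m + (1 - y) ^+ m =
  2 * \sum_(k < N) 'C(m, 2 * k)%:R * y ^+ (2 * k).
Proof.
move=> mN; rewrite !(expr1D_widen _ _ _ _ mN) -big_split /=.
rewrite (sum_even_odd _ (fun i => 'C(m, i)%:R * y ^+ i + 'C(m, i)%:R * (- y) ^+ i)).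
rewrite mulr_sumr; apply: eq_bigr => k _.
by rewrite exprS [(- y) ^+ _.+1]exprS !exprM sqrrN; ring.
Qed.

(** The constant term 2 cancels the -2. Elsewhere the absorption identity m C(m-1, 2k+1) = (2k+2)
    C(m, 2k+2) turns 2/m into 1/(k+1). *)
Lemma phiE (R : realType) (y : R) (m N : nat) : (0 < m)%N -> (m < 2 * N.+1)%N ->
  phi id m y = \sum_(k < N) 'C(m.-1, (2 * k).+1)%:R / k.+1%:R * y ^+ (2 * k.+1).
Proof.
move=> m0 mN; rewrite /phi (expr1D_expr1B _ _ _ _ mN) big_ord_recl /= muln0 bin0 expr0.
rewrite mulr1 [2 * (_ + _)]mulrDr mulr1 [2 + _]addrC addrK !mulr_sumr.
apply: eq_bigr => k _; rewrite /bump /= add1n !mulrA; congr (_ * _).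
have m0R : m%:R != 0 :> R by rewrite pnatr_eq0 -lt0n.
have k0R : k.+1%:R != 0 :> R by rewrite pnatr_eq0.
have := congr1 (fun z : nat => z%:R : R) (mul_bin_diag m (2 * k).+1).
have -> : (2 * k).+2 = (2 * k.+1)%N by lia.
rewrite !natrM => e; apply: (mulfI m0R); rewrite !mulrA e mulfV// mul1r.
by field.
Qed.

Lemma phi_diffE (R : realType) (n : nat) (y : R) :
  phi id n.+2 y - phi id n.+1 y = phi_quotient_poly R n y * y ^+ 2.
Proof.
(* One truncation serves both degrees, since n + 2 < 2 (n/2 + 2) even with the quotient rounded
   down. *)
rewrite !(phiE _ _ _ (n %/ 2).+1)//; [|lia|lia].
rewrite -sumrB mulr_suml; apply: eq_bigr => k _ /=.
rewrite binS natrD mulnS exprD; ring.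
Qed.

Lemma phi_quotient_poly_continuous (R : realType) (n : nat) :
  continuous (phi_quotient_poly R n).
Proof.
move=> y; rewrite /phi_quotient_poly.
apply: cvg_big => [|k _]; first exact: add_continuous.
by apply: cvgM; [exact: cvg_cst|exact: exprn_continuous].
Qed.

Lemma phi_quotientE (R : realType) (f : R -> R) (n : nat) (x : R) :
  phi_quotient f n x = phi_quotient_poly R n (f x).
Proof.
rewrite /phi_quotient; case: eqVneq => [->|fx0].
  apply: cvg_lim => //.
  (* On the punctured neighbourhood the quotient is the polynomial, whose continuity gives the
     limit. *)
  apply: (@cvg_trans _ (phi_quotient_poly R n y @[y --> 0^'])).
    apply: near_eq_cvg; near=> y.
    have y0 : y != 0 by near: y; exact: nbhs_dnbhs_neq.
    by rewrite phi_diffE mulfK// expf_neq0.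
  by apply: cvg_within_filter; exact: phi_quotient_poly_continuous.
have -> : phi f n.+2 x - phi f n.+1 x = phi id n.+2 (f x) - phi id n.+1 (f x) by [].
by rewrite phi_diffE mulfK// expf_neq0.
Unshelve. all: by end_near. Qed.

Lemma measurable_between (R : realType) (a b : \bar R) : measurable (between a b).
Proof.
have -> : between a b = EFin @^-1` [set` `]Order.min a b, Order.max a b[].
  by apply/seteqP; split => x; rewrite /between /= in_itv.
rewrite -[X in measurable X]setTI.
by apply: EFin_measurable => //; exact: emeasurable_itv.
Qed.

Lemma oriented_integral_sum (R : realType) (a b : \bar R) (N : nat)
    (c : nat -> R) (h : nat -> R -> R) :
  (forall k, (@lebesgue_measure R).-integrable (between a b) (EFin \o h k)) ->
  oriented_integral a b (fun x => \sum_(k < N) c k * h k x) =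
  (\sum_(k < N) ((c k)%:E * oriented_integral a b (h k)))%E.
Proof.
move=> hint; have mD := measurable_between R a b.
have E : (\int[@lebesgue_measure R]_(x in between a b)
     (\sum_(k < N) c k * h k x)%:E =
   \sum_(k < N) (c k)%:E * \int[@lebesgue_measure R]_(x in between a b) (h k x)%:E)%E.
  under eq_integral do rewrite -sumEFin.
  rewrite integral_sum//; last first.
    move=> k.
    exact: (@integrableZl _ _ _ (@lebesgue_measure R) _ mD (c k) _ (hint k)).
  by apply: eq_bigr => k _; rewrite -integralZl//; exact: hint.
rewrite /oriented_integral; case: ifP => _; rewrite E//.
(* For reversed endpoints the sign must pass through an extended-real sum, which is safe because
   every term is finite. *)
under [RHS]eq_bigr do rewrite muleN.
rewrite fin_num_sumeN// => k _; rewrite fin_numM//.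
exact: (@integrable_fin_num _ _ _ (@lebesgue_measure R) _ mD _ (hint k)).
Qed.

Theorem theorem11 (R : realType) (a b : \bar R) (f g : R -> R)
  (hf : (@lebesgue_measure R).-integrable (between a b) (EFin \o f))
  (hg : (@lebesgue_measure R).-integrable (between a b) (EFin \o g))
  (hC : forall n : nat,
     (catalan R n)%:E =
     ((n.+1%:R^-1)%R%:E *
      oriented_integral a b (fun x => ((f x) ^+ (2 * n) * g x)%R))%E) :
  forall n : nat,
    (motzkin R n)%:E =
    oriented_integral a b (fun x => phi_quotient f n x * g x).
Proof.
move=> n; have mD := measurable_between R a b.
(* An infinite integral would stay infinite after scaling by the positive 1/(k+1), yet [hC] equates
   the product with a real number. *)
have ofin k : oriented_integral a b (fun x => f x ^+ (2 * k) * g x) \is a fin_num.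
  have := hC k; case: (oriented_integral _ _ _) => [r|/eqP|/eqP] //.
  - by rewrite gt0_muley ?lte_fin ?invr_gt0 ?ltr0n.
  - by rewrite gt0_muleNy ?lte_fin ?invr_gt0 ?ltr0n.
have hint k : (@lebesgue_measure R).-integrable (between a b)
    (EFin \o (fun x => f x ^+ (2 * k) * g x)).
  have mf : measurable_fun (between a b) f.
    by apply/measurable_EFinP; exact: measurable_int hf.
  have mg : measurable_fun (between a b) g.
    by apply/measurable_EFinP; exact: measurable_int hg.
  have mfg : measurable_fun (between a b) (fun x => f x ^+ (2 * k) * g x).
    by apply: measurable_funM => //; exact: measurable_funX.
  apply/integrableP; split; first exact/measurable_EFinP.
  (* For a measurable integrand, finiteness of the integral is finiteness of that of its absolute
     value; orientation only changes the sign. *)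
  rewrite integral_fin_num_abs//.
  by have := ofin k; rewrite /oriented_integral; case: ifP => // _; rewrite fin_numN.
pose c k : R := 'C(n, 2 * k)%:R / k.+1%:R.
have -> : (fun x => phi_quotient f n x * g x) =
    (fun x => \sum_(k < (n %/ 2).+1) c k * (f x ^+ (2 * k) * g x)).
  apply/funext => x; rewrite phi_quotientE mulr_suml.
  by apply: eq_bigr => k _; rewrite mulrA.
rewrite (oriented_integral_sum _ _ _ _ c (fun k x => f x ^+ (2 * k) * g x))//.
rewrite /motzkin -sumEFin; apply: eq_bigr => k _.
(* The 1/(k+1) in [c k] is exactly the prefactor in [hC]. *)
by rewrite EFinM hC muleA -EFinM.
Qed.
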